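(* Let $I$ be an infinite set. For each $i\in I$ let $T_i$ be a compact Hausdorff right topological semigroup and let $A_i$ be a nonempty subset of $T_i$ such that $A_i\subseteq\{ab:a,b\in A_i\}$. Then $J_{\prod_{i\in I}T_i}\big(\prod_{i\in I}A_i\big)=\prod_{i\in I}J_{T_i}(A_i)$.
   Context: A semigroup with a topology is right topological if every right translation $x\mapsto xs$ is continuous. $\prod_{i\in I}T_i$ has the product topology and coordinatewise operation. For a compact Hausdorff right topological semigroup $T$ and $A\subseteq T$, $J_T(A)$ denotes the smallest compact subsemigroup of $T$ containing $A$ (the intersection of all compact subsemigroups of $T$ containing $A$). *)

(* Defs.v *)
From HB Require Import structures.
From mathcomp Require Import all_boot all_classical.
From mathcomp Require Import topology.

Set Implicit Arguments.
Unset Strict Implicit.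
Unset Printing Implicit Defensive.

Local Open Scope classical_set_scope.
Local Open Scope group_scope.

HB.mixin Record Semigroup_isRightTopological T
    of Semigroup T & Topological T := {
  mulgr_continuous : forall s : T, continuous (fun x : T => x * s)
}.

#[short(type="rtSemigroupType")]
HB.structure Definition RightTopologicalSemigroup :=
  {T of Semigroup_isRightTopological T & Semigroup T & Topological T}.

Section ProductSemigroup.
Context {I : Type} (T : I -> rtSemigroupType).

Definition prod_mul (f g : prod_topology T) : prod_topology T :=
  fun i => f i * g i.

Lemma prod_mulA : associative prod_mul.
Proof.
by move=> f g h; apply/functional_extensionality_dep => i; exact: mulgA.
Qed.

HB.instance Definition _ := hasMul.Build (prod_topology T) prod_mul.
HB.instance Definition _ := Magma_isSemigroup.Build (prod_topology T) prod_mulA.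

Lemma prod_mulr_continuous (s : prod_topology T) :
  continuous (fun x : prod_topology T => x * s).
Proof.
move=> f.
have Ff : Filter ((fun x : prod_topology T => x * s) @ f).
  by apply: fmap_filter; exact: nbhs_filter.
apply/cvg_sup => i.
have cpi : continuous (fun x : prod_topology T => x i).
  exact: (@proj_continuous {classic I} T i).
have cmi : continuous (fun x : prod_topology T => x i * s i).
  move=> x.
  exact: (@cvg_comp _ _ _ (fun y : prod_topology T => y i) _ _ _ _ (cpi x)
                    (mulgr_continuous (s i) (x i))).
move=> U [B [[V oV <-] Vf BU]].
apply: (@filterS _ _ _ _ _ BU).
by apply: (cmi f V); apply: open_nbhs_nbhs; split.
Qed.

HB.instance Definition _ :=
  Semigroup_isRightTopological.Build (prod_topology T) prod_mulr_continuous.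

End ProductSemigroup.

(* The empty set is allowed here; it never contains a nonempty set, so J of a
   nonempty set does not depend on this choice. *)
Definition compact_subsemigroup {T : rtSemigroupType} (S : set T) :=
  compact S /\ (forall x y, S x -> S y -> S (x * y)).

(* The library's smallest is the intersection of all sets with the given
   property that contain A. *)
Definition J (T : rtSemigroupType) (A : set T) : set T :=
  smallest compact_subsemigroup A.
Arguments J : clear implicits.

(* Main.v *)
(* Let [S] be a compact, hence closed, subsemigroup containing the box of the
   [A i].  Among the families [B] with [A i] inside [B i], with [B i] inside the
   closure of [B i * B i], and whose box lies in [S], Zorn's lemma provides a
   maximal one: an upper bound of a chain is its union together with [A], and the
   box of the union lies in [S] because finitely many coordinates of a point
   already lie in one member of the chain, while the others may be moved into
   the nonempty sets [A i].  Replacing each [B i] by the closure of [B i * B i]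
   gives a family of the same kind that is at least as large, so maximality
   makes every [B i] a closed subsemigroup containing [A i].  Then
   [J (T i) (A i)] lies in [B i], and the box of the [J (T i) (A i)] in [S]. *)

Require Import Defs.
From HB Require Import structures.
From mathcomp Require Import all_boot all_classical.
From mathcomp Require Import topology.

Local Open Scope classical_set_scope.
Local Open Scope group_scope.

(** The sets [W] with this property form a filter, and the product topology is the supremum of the
    topologies pulled back along the projections, so convergence of that filter to [f] can be
    checked one coordinate at a time. *)
Lemma nbhs_prod_box (I : Type) (T : I -> topologicalType)
    (f : prod_topology T) (W : set (prod_topology T)) :
  nbhs f W ->
  exists (D : set I) (V : forall i, set (T i)),
    [/\ finite_set D, forall i, nbhs (f i) (V i) &
        [set g | forall i, D i -> V i (g i)] `<=` W].
Proof.
pose F : set_system (prod_topology T) := fun W =>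
  exists (D : set I) (V : forall i, set (T i)),
    [/\ finite_set D, forall i, nbhs (f i) (V i) &
        [set g | forall i, D i -> V i (g i)] `<=` W].
have FF : Filter F.
  split.
  - by exists set0, (fun=> setT); split => // i; exact: filterT.
  - move=> P Q [D [V [fD nV VP]]] [E [U [fE nU UQ]]].
    exists (D `|` E), (fun i => V i `&` U i); split.
    + by rewrite finite_setU.
    + by move=> i; exact: filterI.
    + move=> g /= Hg; split.
        by apply: VP => i Di; have [] := Hg i (or_introl Di).
      by apply: UQ => i Ei; have [] := Hg i (or_intror Ei).
  - move=> P Q PQ [D [V [fD nV VP]]]; exists D, V; split=> //.
    exact: subset_trans VP PQ.
suff Ff : F --> f by exact: Ff.
apply/cvg_sup => i U [_ [[V oV <-] Vf VU]].
apply: (filterS VU).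
(* [V] at [i] and everything elsewhere, without deciding [j = i] *)
exists [set i], (fun j => [set y | forall e : j = i, V (eq_rect j T y i e)]).
split=> //.
- move=> j; have [ji|nji] := pselect (j = i).
    subst j; apply: filterS (open_nbhs_nbhs (conj oV Vf)) => y Vy e.
    by rewrite (Prop_irrelevance e erefl).
  by apply: filterS filterT => y _ e; case: (nji e).
- by move=> g /(_ i erefl) /(_ erefl).
Qed.

(** Reduces membership in [S] to finitely many coordinates: [g] may be chosen freely outside [D]. *)
Lemma closed_prod_approx (I : Type) (T : I -> topologicalType)
    (S : set (prod_topology T)) (f : prod_topology T) :
  closed S ->
  (forall (D : set I) (V : forall i, set (T i)), finite_set D ->
    (forall i, nbhs (f i) (V i)) ->
    exists2 g, S g & forall i, D i -> V i (g i)) ->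
  S f.
Proof.
move=> cS H; apply: cS => W /nbhs_prod_box [D [V [fD nV VW]]].
have [g Sg Vg] := H D V fD nV.
by exists g; split => //; exact: VW.
Qed.

Lemma total_on_finite_ub (X Y : Type) (R : Y -> Y -> Prop) (C : set Y)
    (D : set X) (h : X -> Y) (y0 : Y) :
  (forall y, R y y) -> (forall x y z, R x y -> R y z -> R x z) ->
  total_on C R -> C y0 -> finite_set D -> (forall x, C (h x)) ->
  exists2 y, C y & forall x, D x -> R (h x) y.
Proof.
move=> Rr Rt Ct Cy0 fD Ch.
have [s Ds] : exists s : seq {classic X}, D = [set` s] by apply/finite_seqP.
rewrite {}Ds {D fD}.
elim: s => [|x s [y Cy Hy]]; first by exists y0.
have [yx|xy] := Ct _ _ Cy (Ch x).
- exists (h x) => // z /=; rewrite inE => /orP[/eqP->//|zs].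
  by apply: Rt yx; exact: Hy.
- by exists y => // z /=; rewrite inE => /orP[/eqP->//|zs]; exact: Hy.
Qed.

(** Compact subsets of a Hausdorff space are closed, so their intersection is closed in the compact
    [T]. *)
Lemma compact_subsemigroup_J (T : rtSemigroupType) (A : set T) :
  compact [set: T] -> hausdorff_space T -> compact_subsemigroup (J T A).
Proof.
move=> cT hT; split.
- apply: (subclosed_compact _ cT) => //.
  apply: closed_bigI => S [[cS _] _].
  exact: compact_closed.
- move=> x y Jx Jy S SA; have [[_ mS] _] := SA.
  by apply: mS; [exact: Jx|exact: Jy].
Qed.

Lemma compact_subsemigroup_box (I : Type) (T : I -> rtSemigroupType)
    (K : forall i, set (T i)) :
  (forall i, compact_subsemigroup (K i)) ->
  @compact_subsemigroup (prod_topology T) [set f | forall i, K i (f i)].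
Proof.
move=> HK; split.
- exact: (@tychonoff {classic I} T K (fun i => (HK i).1)).
- by move=> f g Kf Kg i; apply: (HK i).2.
Qed.

Section BoxInSubsemigroup.
Context {I : Type} {T : I -> rtSemigroupType} {A : forall i, set (T i)}.
Context {S : set (prod_topology T)}.
Hypotheses (A0 : forall i, A i !=set0)
  (AA : forall i, A i `<=` [set a * b | a in A i & b in A i])
  (cS : closed S) (mS : forall f g, S f -> S g -> S (f * g))
  (AS : [set f | forall i, A i (f i)] `<=` S).

Let mulset (i : I) (B : set (T i)) : set (T i) :=
  [set a * b | a in B & b in B].

Let mulsetS (i : I) (B C : set (T i)) :
  B `<=` C -> mulset i B `<=` mulset i C.
Proof.
move=> BC _ [a Ba [b Bb <-]].
by exists a; [exact: BC|exists b; [exact: BC|]].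
Qed.

(** By monotonicity of [mulset] and [closure], the second condition passes to unions of chains and
    to the closures of [mulset i (B i)]. *)
Let admissible (B : forall i, set (T i)) :=
  [/\ forall i, A i `<=` B i,
      forall i, B i `<=` closure (mulset i (B i)) &
      [set f | forall i, B i (f i)] `<=` S].

Let admissible_A : admissible A.
Proof. by split=> [i|i x /AA|]; [|exact: subset_closure|]. Qed.

Let admissible_step B :
  admissible B -> admissible (fun i => closure (mulset i (B i))).
Proof.
move=> [AB Bcl BS]; split.
- by move=> i; exact: subset_trans (AB i) (Bcl i).
- by move=> i; apply: closureS; apply: mulsetS.
- move=> f Bf; apply: closed_prod_approx cS _ => D V _ nV.
  (* Choosing such a pair for every [i] at once gives two points of the box of [B]; their product
     approximates [f] and lies in [S]. *)
  have H i : exists p : T i * T i, [/\ B i p.1, B i p.2 & V i (p.1 * p.2)].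
    have [_ [[a Ba [b Bb <-]] Vab]] := Bf i _ (nV i).
    by exists (a, b).
  have [h Hh] := all_sig (fun i => cid (H i)).
  exists (fun i => (h i).1 * (h i).2); last by move=> i _; have [] := Hh i.
  by apply: (mS (fun i => (h i).1) (fun i => (h i).2)); apply: BS => i;
    have [] := Hh i.
Qed.

Let le_fam (B C : {B | admissible B}) : bool :=
  `[< forall i, sval B i `<=` sval C i >].

Let le_refl B : le_fam B B. Proof. by apply/asboolP => i x. Qed.

Let le_trans B C E : le_fam B C -> le_fam C E -> le_fam B E.
Proof.
move=> /asboolP BC /asboolP CE; apply/asboolP => i.
exact: subset_trans (BC i) (CE i).
Qed.

Let chain_ub (F : set {B | admissible B}) :
  total_on F (fun B C => le_fam B C) ->
  exists B, forall C, F C -> le_fam C B.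
Proof.
move=> totF.
pose A' : {B | admissible B} := exist _ A admissible_A.
have A'_le B : le_fam A' B by apply/asboolP; case: B => B [].
(* [A'] is least, so the chain stays total, and the union contains every [A i] even when [F] is
   empty. *)
pose G := F `|` [set A'].
have totG : total_on G (fun B C => le_fam B C).
  move=> B C [FB|->] [FC|->]; [exact: totF|by right|by left|by left].
pose U i := [set x : T i | exists2 B, G B & sval B i x].
have UP : admissible U.
  split.
  - by move=> i x Ax; exists A' => //; right.
  - move=> i x [B GB Bx]; have [_ Bcl _] := svalP B.
    apply: closureS (Bcl i x Bx).
    by apply: mulsetS => y By; exists B.
  - move=> f Uf; apply: closed_prod_approx cS _ => D V fD nV.
    (* [h i] is a member of the chain whose set at [i] contains [f i]; the next step bounds the
       [h i] with [i] in [D] by a single member. *)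
    have [h Hh] := choice (fun i => let: ex_intro2 B GB Bf := Uf i in
      ex_intro (fun B => G B /\ sval B i (f i)) B (conj GB Bf)).
    have [B GB DB] := @total_on_finite_ub _ _ (fun B C => le_fam B C) G D h A'
      le_refl le_trans totG (or_intror erefl) fD (fun i => (Hh i).1).
    have [AB _ BS] := svalP B.
    have H i : exists x, sval B i x /\ (D i -> V i x).
      have [Di|nDi] := pselect (D i).
        exists (f i); split; last by move=> _; exact: nbhs_singleton (nV i).
        by have /asboolP := DB i Di; apply; exact: (Hh i).2.
      by have [x Ax] := A0 i; exists x; split => //; exact: AB.
    have [g Hg] := all_sig (fun i => cid (H i)).
    by exists g; [apply: BS => i; exact: (Hg i).1|move=> i; exact: (Hg i).2].
exists (exist _ U UP) => C FC; apply/asboolP => i x Cx /=.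
by exists C => //; left.
Qed.

Lemma closed_subsemigroup_box_sub :
  exists B : forall i, set (T i),
    [/\ forall i, A i `<=` B i, forall i, closed (B i),
        forall i x y, B i x -> B i y -> B i (x * y) &
        [set f | forall i, B i (f i)] `<=` S].
Proof.
have [[B PB] maxB] := @ZL_preorder _ (exist _ A admissible_A) le_fam
  le_refl le_trans chain_ub.
have [AB Bcl BS] := PB.
(* The family of closures lies above [B], so by maximality it also lies below [B]. *)
have /asboolP /= clB : le_fam (exist _ _ (admissible_step B PB)) (exist _ B PB).
  by apply: maxB; exact/asboolP.
exists B; split => // i.
- have -> : B i = closure (mulset i (B i)) by apply/seteqP; split.
  exact: closed_closure.
- move=> x y Bx By; apply: clB; apply: subset_closure.
  by exists x => //; exists y.
Qed.

End BoxInSubsemigroup.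

Theorem theorem4p15 (I : Type) (T : I -> rtSemigroupType)
    (A : forall i, set (T i)) :
  infinite_set [set: I] ->
  (forall i, compact [set: T i]) ->
  (forall i, hausdorff_space (T i)) ->
  (forall i, A i !=set0) ->
  (forall i, A i `<=` [set a * b | a in A i & b in A i]) ->
  J (prod_topology T) [set f | forall i, A i (f i)]
  = [set f | forall i, J (T i) (A i) (f i)].
Proof.
move=> _ cT hT A0 AA; apply/seteqP; split.
- apply: smallest_sub.
    apply: (compact_subsemigroup_box I T (fun i => J (T i) (A i))) => i.
    exact: compact_subsemigroup_J (cT i) (hT i).
  by move=> f Af i; apply: (sub_smallest _ (Af i)).
- move=> f Jf S [[cS mS] AS].
  have clS : closed S.
    by apply: compact_closed cS; exact: (@hausdorff_product {classic I} T hT).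
  have [B [AB clB mB BS]] := closed_subsemigroup_box_sub A0 AA clS mS AS.
  (* Each [B i] is one of the sets whose intersection is [J (T i) (A i)]. *)
  apply: BS => i; apply: Jf; split => //; split; last exact: mB.
  exact: subclosed_compact (clB i) (cT i) _.
Qed.
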